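(* (a) Suppose $\{Q^A,Q^B\}$ is a weakly separated collection of blocks such that the start-node set $W^A\smallsetminus Y^A$ is disjoint from the end-node set $Y^B\smallsetminus W^B$. Then $Q^A\cup Q^B$ is a block whose start-node set is the union of $$W^A\smallsetminus Y^A\quad\text{and}\quad (W^B\smallsetminus Y^B)\smallsetminus(Y^A\smallsetminus W^A)$$ and whose end-node set is the union of $$(Y^A\smallsetminus W^A)\smallsetminus(W^B\smallsetminus Y^B)\quad\text{and}\quad Y^B\smallsetminus W^B.$$ (b) Suppose $\mathcal Q$ is a strongly separated collection of blocks. Then $\bigcup\mathcal Q$ is a block with start-node set $\bigcup_{Q\in\mathcal Q}(\pi_W(Q)\smallsetminus\pi_Y(Q))$ and end-node set $\bigcup_{Q\in\mathcal Q}(\pi_Y(Q)\smallsetminus\pi_W(Q))$.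
   Context: A quintuple $\langle i,j,w,a,y\rangle$ has arbitrary objects as components, called player, situation, decision node, action, successor node. Decision nodes and successor nodes are both nodes (the same object may occur as both). A quintuple set $Q$ is a (possibly infinite) set of quintuples. For a string of letters from $I,J,W,A,Y$, $\pi_{\cdots}(Q)$ is the projection of $Q$ onto those coordinates, in the order listed, e.g. $\pi_{JI}(Q)=\{\langle j,i\rangle\mid \exists w,a,y:\ \langle i,j,w,a,y\rangle\in Q\}$. Write $J=\pi_J(Q)$, $W=\pi_W(Q)$, $Y=\pi_Y(Q)$; markings on $Q$ carry over, e.g. $W^A=\pi_W(Q^A)$, $Y^B=\pi_Y(Q^B)$, $J^A=\pi_J(Q^A)$. For $j\in J$, the slice is $Q_j=\{\langle i_*,j_*,w_*,a_*,y_*\rangle\in Q\mid j_*=j\}$. A function is a set $f$ of couples such that $\langle x,z\rangle,\langle x,z'\rangle\in f$ implies $z=z'$. A block is a quintuple set $Q$ such that: [Pij] $\pi_{JI}(Q)$ is a function; [Pjw] $\pi_{WJ}(Q)$ is a function; [Pwa] for all $j\in J$, $\pi_{WA}(Q_j)$ is a Cartesian product; [Pway] $\{\langle\langle w,a\rangle,y\rangle\mid\langle w,a,y\rangle\in\pi_{WAY}(Q)\}$ is a function; [Pwy] $\pi_{YW}(Q)$ is a function, denoted $p$; [Pay] $\pi_{YA}(Q)$ is a function; [Py] for every $y\in Y$ there is $m\ge1$ with $p^m(y)\notin Y$ (iterates of $p$ from $y$ eventually leave $Y$). For any quintuple set $Q$, the start-node set is $W\smallsetminus Y$ and the end-node set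 is $Y\smallsetminus W$. A collection $\mathcal Q$ of quintuple sets is weakly separated iff for all distinct $Q^A,Q^B\in\mathcal Q$: $J^A\cap J^B=\varnothing$, $W^A\cap W^B=\varnothing$, and $Y^A\cap Y^B=\varnothing$. It is strongly separated iff for all distinct $Q^A,Q^B\in\mathcal Q$: $J^A\cap J^B=\varnothing$ and $(W^A\cup Y^A)\cap(W^B\cup Y^B)=\varnothing$. *)

(* Defs.v *)
From mathcomp Require Import all_boot.
From mathcomp Require Import boolp classical_sets.
Set Implicit Arguments.
Unset Strict Implicit.
Unset Printing Implicit Defensive.

Local Open Scope classical_set_scope.

(* Decision nodes and successor nodes share the type N, because a node may play
   both roles.  The other components are never compared across roles, so their
   types are kept independent; taking I = J = N = A is the untyped case. *)
Record quintuple (I J N A : Type) := Quintuple {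
  player : I;
  situation : J;
  decision_node : N;
  action : A;
  successor_node : N }.

Definition is_function (X Z : Type) (f : set (X * Z)) : Prop :=
  forall x z z', f (x, z) -> f (x, z') -> z = z'.

Definition is_cartesian_product (X Z : Type) (S : set (X * Z)) : Prop :=
  exists (C : set X) (D : set Z), S = C `*` D.

(* Relational iterate of a set of couples: [iter_graph f m (x, z)] says that
   [f^m(x)] is defined and equal to [z] (when [f] is a function). *)
Fixpoint iter_graph (X : Type) (f : set (X * X)) (m : nat) : set (X * X) :=
  if m is k.+1 then
    [set xz | exists2 y, iter_graph f k (xz.1, y) & f (y, xz.2)]
  else [set xz | xz.1 = xz.2].

Section QuintupleSets.
Variables (I J N A : Type).
Implicit Type Q : set (quintuple I J N A).

Definition pi_J Q : set J := [set situation q | q in Q].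
Definition pi_W Q : set N := [set decision_node q | q in Q].
Definition pi_Y Q : set N := [set successor_node q | q in Q].
Definition pi_JI Q : set (J * I) := [set (situation q, player q) | q in Q].
Definition pi_WJ Q : set (N * J) :=
  [set (decision_node q, situation q) | q in Q].
Definition pi_WA Q : set (N * A) := [set (decision_node q, action q) | q in Q].
Definition pi_YW Q : set (N * N) :=
  [set (successor_node q, decision_node q) | q in Q].
Definition pi_YA Q : set (N * A) := [set (successor_node q, action q) | q in Q].
Definition pi_WAY Q : set (N * A * N) :=
  [set (decision_node q, action q, successor_node q) | q in Q].

Definition slice Q (j : J) : set (quintuple I J N A) :=
  [set q | Q q /\ situation q = j].

(* In [Pway], a triple (w, a, y) is by notation the couple ((w, a), y). *)
Record block Q : Prop := Block {
  Pij : is_function (pi_JI Q);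
  Pjw : is_function (pi_WJ Q);
  Pwa : forall j, pi_J Q j -> is_cartesian_product (pi_WA (slice Q j));
  Pway : is_function (pi_WAY Q);
  Pwy : is_function (pi_YW Q);
  Pay : is_function (pi_YA Q);
  Py : forall y, pi_Y Q y ->
    exists m z, [/\ (1 <= m)%N, iter_graph (pi_YW Q) m (y, z) & ~ pi_Y Q z] }.

Definition start_nodes Q : set N := pi_W Q `\` pi_Y Q.
Definition end_nodes Q : set N := pi_Y Q `\` pi_W Q.

Implicit Type QQ : set (set (quintuple I J N A)).

Definition weakly_separated QQ : Prop :=
  forall QA QB, QQ QA -> QQ QB -> QA <> QB ->
  [/\ pi_J QA `&` pi_J QB = set0,
      pi_W QA `&` pi_W QB = set0 &
      pi_Y QA `&` pi_Y QB = set0].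

Definition strongly_separated QQ : Prop :=
  forall QA QB, QQ QA -> QQ QB -> QA <> QB ->
  pi_J QA `&` pi_J QB = set0 /\
  (pi_W QA `|` pi_Y QA) `&` (pi_W QB `|` pi_Y QB) = set0.

End QuintupleSets.

(* Main.v *)
Require Import Defs.
From mathcomp Require Import all_boot.
From mathcomp Require Import boolp classical_sets.

(** Each separation condition says that two quintuples sharing a situation, a
    decision node or a successor node come from the same block, so every axiom
    but [Py] is inherited from a single block. For [Py], iterating the
    predecessor map inside a block leads to a start node of that block. In part
    (b) such a node lies outside every other block. In part (a) a start node of
    [QA] cannot lie in [Y^B], for it would then be an end node of [QB] or lie in
    [W^A] and [W^B]; hence a path from [Y^B] that exits into [Y^A] needs only
    one further descent. *)

Set Implicit Arguments.
Unset Strict Implicit.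

Local Open Scope classical_set_scope.

(** * Iterates of graphs and projections of unions *)

Lemma iter_graph_sub (X : Type) (f g : set (X * X)) (m : nat) :
  f `<=` g -> iter_graph f m `<=` iter_graph g m.
Proof.
move=> fg; elim: m => [//|m IHm] [x z] [y fxy fyz].
by exists y; [exact: IHm | exact: fg].
Qed.

Lemma iter_graph_trans (X : Type) (f : set (X * X)) (m n : nat) (x y z : X) :
  iter_graph f m (x, y) -> iter_graph f n (y, z) ->
  iter_graph f (n + m) (x, z).
Proof.
move=> fxy; elim: n z => [|n IHn] z /=; first by move=> <-.
by move=> [t fyt ftz]; exists t => //; exact: IHn.
Qed.

Lemma disjointP (T : Type) (X Z : set T) :
  X `&` Z = set0 <-> forall x, X x -> ~ Z x.
Proof.
split=> [XZ0 x Xx Zx|XZ]; first by rewrite -[False]/(set0 x) -XZ0.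
by rewrite -subset0 => x [/XZ].
Qed.

Lemma pi_W_setU (I J N A : Type) (QA QB : set (quintuple I J N A)) :
  pi_W (QA `|` QB) = pi_W QA `|` pi_W QB.
Proof. exact: image_setU. Qed.

Lemma pi_Y_setU (I J N A : Type) (QA QB : set (quintuple I J N A)) :
  pi_Y (QA `|` QB) = pi_Y QA `|` pi_Y QB.
Proof. exact: image_setU. Qed.

Lemma pi_W_bigcup (I J N A : Type) (QQ : set (set (quintuple I J N A))) :
  pi_W (\bigcup_(Q in QQ) Q) = \bigcup_(Q in QQ) pi_W Q.
Proof. exact: image_bigcup. Qed.

Lemma pi_Y_bigcup (I J N A : Type) (QQ : set (set (quintuple I J N A))) :
  pi_Y (\bigcup_(Q in QQ) Q) = \bigcup_(Q in QQ) pi_Y Q.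
Proof. exact: image_bigcup. Qed.

(** Since [m] is at least 1, the path given by [Py] has a last step, and the end of that step is a
    decision node. *)
Lemma block_reaches_start (I J N A : Type) (Q : set (quintuple I J N A))
    (y : N) :
  block Q -> pi_Y Q y ->
  exists m z, [/\ (1 <= m)%N, iter_graph (pi_YW Q) m (y, z) & start_nodes Q z].
Proof.
move=> bQ /(Py bQ) [[|m] [z [//]]] m1 yz nYz; exists m.+1, z; split=> //.
by split=> //; case: yz => t _ [q Qq [_ <-]]; exists q.
Qed.

Lemma weakly_separated_inj (I J N A : Type)
    (QQ : set (set (quintuple I J N A))) (Q Q' : set (quintuple I J N A))
    (q q' : quintuple I J N A) :
  weakly_separated QQ -> QQ Q -> QQ Q' -> Q q -> Q' q' ->
  [\/ situation q = situation q', decision_node q = decision_node q' |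
      successor_node q = successor_node q'] ->
  Q = Q'.
Proof.
move=> sepQQ QQQ QQQ' Qq Qq' eqq'; apply: contrapT => neQ.
have [/disjointP dJ /disjointP dW /disjointP dY] := sepQQ _ _ QQQ QQQ' neQ.
case: eqq' => e; [apply: (dJ (situation q)) | apply: (dW (decision_node q))
  | apply: (dY (successor_node q))]; by [exists q | exists q'].
Qed.

(** [Py] stays a hypothesis because weak separation does not yield it: two blocks may each have the
    other's start node as an end node, and their union then has a cycle. *)
Lemma block_bigcup (I J N A : Type) (QQ : set (set (quintuple I J N A))) :
  (forall Q, QQ Q -> block Q) -> weakly_separated QQ ->
  (forall y, pi_Y (\bigcup_(Q in QQ) Q) y ->
    exists m z, [/\ (1 <= m)%N,
      iter_graph (pi_YW (\bigcup_(Q in QQ) Q)) m (y, z) &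
      ~ pi_Y (\bigcup_(Q in QQ) Q) z]) ->
  block (\bigcup_(Q in QQ) Q).
Proof.
move=> bQQ sepQQ PyQQ; split=> //.
- move=> j i i' [q [Q QQQ Qq] [ej <-]] [q' [Q' QQQ' Qq'] [ej' <-]].
  have eQ : Q = Q'.
    by apply: (weakly_separated_inj sepQQ QQQ QQQ' Qq Qq'); rewrite ej ej';
      apply: Or31.
  subst Q'; apply: (Pij (bQQ _ QQQ)); first by exists q.
  by exists q' => //; rewrite ej ej'.
- move=> w j j' [q [Q QQQ Qq] [ew <-]] [q' [Q' QQQ' Qq'] [ew' <-]].
  have eQ : Q = Q'.
    by apply: (weakly_separated_inj sepQQ QQQ QQQ' Qq Qq'); rewrite ew ew';
      apply: Or32.
  subst Q'; apply: (Pjw (bQQ _ QQQ)); first by exists q.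
  by exists q' => //; rewrite ew ew'.
- move=> j [q [Q QQQ Qq] ej].
  (* A situation belongs to one block only, so no Cartesian product has to be assembled across
     blocks. *)
  suff -> : slice (\bigcup_(Q in QQ) Q) j = slice Q j.
    by apply: (Pwa (bQQ _ QQQ)); exists q.
  apply/seteqP; split=> q' [Qq' ej']; last by split=> //; exists Q.
  case: Qq' => Q' QQQ' Qq'; split=> //.
  rewrite (weakly_separated_inj sepQQ QQQ QQQ' Qq Qq') //.
  by rewrite ej ej'; apply: Or31.
- move=> [w a] y y' [q [Q QQQ Qq] [ew ea <-]] [q' [Q' QQQ' Qq'] [ew' ea' <-]].
  have eQ : Q = Q'.
    by apply: (weakly_separated_inj sepQQ QQQ QQQ' Qq Qq'); rewrite ew ew';
      apply: Or32.
  subst Q'; apply: (Pway (bQQ _ QQQ)); first by exists q.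
  by exists q' => //; rewrite ew ew' ea ea'.
- move=> y w w' [q [Q QQQ Qq] [ey <-]] [q' [Q' QQQ' Qq'] [ey' <-]].
  have eQ : Q = Q'.
    by apply: (weakly_separated_inj sepQQ QQQ QQQ' Qq Qq'); rewrite ey ey';
      apply: Or33.
  subst Q'; apply: (Pwy (bQQ _ QQQ)); first by exists q.
  by exists q' => //; rewrite ey ey'.
- move=> y a a' [q [Q QQQ Qq] [ey <-]] [q' [Q' QQQ' Qq'] [ey' <-]].
  have eQ : Q = Q'.
    by apply: (weakly_separated_inj sepQQ QQQ QQQ' Qq Qq'); rewrite ey ey';
      apply: Or33.
  subst Q'; apply: (Pay (bQQ _ QQQ)); first by exists q.
  by exists q' => //; rewrite ey ey'.
Qed.

(** * Strongly separated collections *)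

Lemma strongly_separated_weakly (I J N A : Type)
    (QQ : set (set (quintuple I J N A))) :
  strongly_separated QQ -> weakly_separated QQ.
Proof.
move=> sepQQ QA QB QQA QQB neAB.
have [dJ /disjointP dN] := sepQQ _ _ QQA QQB neAB.
by split=> //; apply/disjointP => x Ax Bx;
  [apply: (dN x); left | apply: (dN x); right].
Qed.

(** Unlike weak separation, this also covers a node that is a decision node of [Q] and a successor
    node of [Q']. *)
Lemma strongly_separated_inj (I J N A : Type)
    (QQ : set (set (quintuple I J N A))) (Q Q' : set (quintuple I J N A))
    (x : N) :
  strongly_separated QQ -> QQ Q -> QQ Q' ->
  (pi_W Q `|` pi_Y Q) x -> (pi_W Q' `|` pi_Y Q') x -> Q = Q'.
Proof.
move=> sepQQ QQQ QQQ' Qx Qx'; apply: contrapT => neQ.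
by have [_ /disjointP /(_ x Qx)] := sepQQ _ _ QQQ QQQ' neQ.
Qed.

Lemma start_nodes_strong_bigcup (I J N A : Type)
    (QQ : set (set (quintuple I J N A))) :
  strongly_separated QQ ->
  start_nodes (\bigcup_(Q in QQ) Q) = \bigcup_(Q in QQ) (pi_W Q `\` pi_Y Q).
Proof.
move=> sepQQ; rewrite /start_nodes pi_W_bigcup pi_Y_bigcup.
apply/seteqP; split=> [x [[Q QQQ Wx] nYx]|x [Q QQQ [Wx nYx]]].
  by exists Q => //; split=> // Yx; apply: nYx; exists Q.
split=> [|[Q' QQQ' Yx]]; first by exists Q.
apply: nYx; rewrite (strongly_separated_inj sepQQ QQQ QQQ' (x := x)) //.
  by left.
by right.
Qed.

Lemma end_nodes_strong_bigcup (I J N A : Type)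
    (QQ : set (set (quintuple I J N A))) :
  strongly_separated QQ ->
  end_nodes (\bigcup_(Q in QQ) Q) = \bigcup_(Q in QQ) (pi_Y Q `\` pi_W Q).
Proof.
move=> sepQQ; rewrite /end_nodes pi_W_bigcup pi_Y_bigcup.
apply/seteqP; split=> [x [[Q QQQ Yx] nWx]|x [Q QQQ [Yx nWx]]].
  by exists Q => //; split=> // Wx; apply: nWx; exists Q.
split=> [|[Q' QQQ' Wx]]; first by exists Q.
apply: nWx; rewrite (strongly_separated_inj sepQQ QQQ QQQ' (x := x)) //.
  by right.
by left.
Qed.

Lemma block_strong_bigcup (I J N A : Type)
    (QQ : set (set (quintuple I J N A))) :
  (forall Q, QQ Q -> block Q) -> strongly_separated QQ ->
  block (\bigcup_(Q in QQ) Q).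
Proof.
move=> bQQ sepQQ; apply: block_bigcup => //.
  exact: strongly_separated_weakly.
rewrite {1}pi_Y_bigcup => y [Q QQQ Yy].
have [m [z [m1 yz sz]]] := block_reaches_start (bQQ _ QQQ) Yy.
exists m, z; split=> //.
  by apply: iter_graph_sub yz; apply: image_subset; exact: bigcup_sup.
(* The path stays inside [Q], and its end remains a start node of the whole union. *)
have : start_nodes (\bigcup_(Q in QQ) Q) z.
  by rewrite start_nodes_strong_bigcup //; exists Q.
by case.
Qed.

(** * Weakly separated pairs *)

Lemma start_nodes_disjoint_pi_Y (I J N A : Type)
    (QA QB : set (quintuple I J N A)) (x : N) :
  pi_W QA `&` pi_W QB = set0 -> start_nodes QA `&` end_nodes QB = set0 ->
  start_nodes QA x -> ~ pi_Y QB x.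
Proof.
move=> /disjointP dW /disjointP dSE sx YBx.
by apply: (dSE _ sx); split=> // WBx; case: sx => /dW.
Qed.

(** Disjointness of the decision nodes is stated apart, as weak separation gives it only when [QA]
    and [QB] differ. *)
Lemma block_setU (I J N A : Type) (QA QB : set (quintuple I J N A)) :
  (forall Q, [set QA; QB] Q -> block Q) ->
  weakly_separated [set QA; QB] ->
  pi_W QA `&` pi_W QB = set0 -> start_nodes QA `&` end_nodes QB = set0 ->
  block (QA `|` QB).
Proof.
move=> bAB sepAB dW dSE.
have bA : block QA by apply: bAB; left.
have bB : block QB by apply: bAB; right.
have eU : \bigcup_(Q in [set QA; QB]) Q = QA `|` QB.
  by rewrite bigcup_setU !bigcup_set1.
have subA : pi_YW QA `<=` pi_YW (QA `|` QB).
  by apply: image_subset; exact: subsetUl.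
have subB : pi_YW QB `<=` pi_YW (QA `|` QB).
  by apply: image_subset; exact: subsetUr.
have PyA y : pi_Y QA y -> exists m z, [/\ (1 <= m)%N,
    iter_graph (pi_YW (QA `|` QB)) m (y, z) & ~ pi_Y (QA `|` QB) z].
  move=> /(block_reaches_start bA) [m [z [m1 yz sz]]].
  exists m, z; split=> //; first exact: iter_graph_sub yz.
  rewrite pi_Y_setU => -[YAz|]; first by case: sz.
  exact: start_nodes_disjoint_pi_Y sz.
rewrite -eU; apply: block_bigcup; rewrite // eU {1}pi_Y_setU => y [/PyA //|].
move=> /(block_reaches_start bB) [m [z [m1 yz [_ nYBz]]]].
have {}yz := iter_graph_sub subB yz.
(* At most one passage from [QB] to [QA] occurs, because the path supplied by [PyA] already ends
   outside both sets of successor nodes. *)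
have [/PyA [n [t [n1 zt nYt]]]|nYAz] := pselect (pi_Y QA z).
  exists (n + m)%N, t; split=> //; first by rewrite addn_gt0 n1.
  exact: iter_graph_trans yz zt.
by exists m, z; split=> //; rewrite pi_Y_setU => -[].
Qed.

Theorem proposition4p4 (I J N A : Type) :
  (forall QA QB : set (quintuple I J N A),
     (forall Q, [set QA; QB] Q -> block Q) ->
     weakly_separated [set QA; QB] ->
     (pi_W QA `\` pi_Y QA) `&` (pi_Y QB `\` pi_W QB) = set0 ->
     [/\ block (QA `|` QB),
         start_nodes (QA `|` QB) =
           (pi_W QA `\` pi_Y QA) `|`
           ((pi_W QB `\` pi_Y QB) `\` (pi_Y QA `\` pi_W QA)) &
         end_nodes (QA `|` QB) =
           ((pi_Y QA `\` pi_W QA) `\` (pi_W QB `\` pi_Y QB)) `|`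
           (pi_Y QB `\` pi_W QB)]) /\
  (forall QQ : set (set (quintuple I J N A)),
     (forall Q, QQ Q -> block Q) ->
     strongly_separated QQ ->
     [/\ block (\bigcup_(Q in QQ) Q),
         start_nodes (\bigcup_(Q in QQ) Q) =
           \bigcup_(Q in QQ) (pi_W Q `\` pi_Y Q) &
         end_nodes (\bigcup_(Q in QQ) Q) =
           \bigcup_(Q in QQ) (pi_Y Q `\` pi_W Q)]).
Proof.
split=> [QA QB bAB sepAB dSE|QQ bQQ sepQQ]; last first.
  split; first exact: block_strong_bigcup.
  - exact: start_nodes_strong_bigcup.
  - exact: end_nodes_strong_bigcup.
(* When [QA = QB], weak separation says nothing, but the union is [QA] and both formulas
   collapse. *)
have [eAB|neAB] := pselect (QA = QB).
  have bA : block QA by apply: bAB; left.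
  subst QB; rewrite setUid; split=> //; apply/seteqP; split=> x.
  - by left.
  - by move=> [|[]].
  - by right.
  - by move=> [[]|].
have [] := sepAB QA QB (or_introl erefl) (or_intror erefl) neAB.
move=> _ dW /disjointP dY.
have sAB x := @start_nodes_disjoint_pi_Y _ _ _ _ _ _ x dW dSE.
split; first exact: block_setU.
all: rewrite /start_nodes /end_nodes pi_W_setU pi_Y_setU.
all: move/disjointP: dW => dW.
- apply/seteqP; split=> x.
    move=> [[Wx|Wx] nYx]; [left|right]; split=> //.
    + by move=> Yx; apply: nYx; left.
    + by split=> // Yx; apply: nYx; right.
    + by move=> [Yx _]; apply: nYx; left.
  move=> [sx|[[WBx nYBx] nEx]].
    by split=> [|[Yx|/(sAB _ sx)//]]; [left; case: sx | case: sx].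
  split=> [|[YAx|//]]; first by right.
  (* A start node [x] of [QB] lying in [pi_Y QA] is outside [pi_W QA] by [dW], so it is an end node
     of [QA], which [nEx] excludes. *)
  by apply: nEx; split=> // /dW.
- apply/seteqP; split=> x.
    move=> [[Yx|Yx] nWx]; [left|right]; split=> //.
    + by split=> // Wx; apply: nWx; left.
    + by move=> [Wx _]; apply: nWx; right.
    + by move=> Wx; apply: nWx; right.
  move=> [[[YAx nWAx] nSx]|[YBx nWBx]].
    split=> [|[//|WBx]]; first by left.
    (* Here [dY] turns [x] into a start node of [QB]. *)
    by apply: nSx; split=> // /(dY _ YAx).
  split=> [|[WAx|//]]; first by right.
  (* An end node of [QB] in [pi_W QA] would by [dY] be a start node of [QA], and [sAB] keeps those
     out of [pi_Y QB]. *)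
  by apply: (sAB x) => //; split=> // /dY.
Qed.
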